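(* Let $F$ be an unsatisfiable clause-set. Consider the following game between Prover and Delayer on a partial assignment $\theta$ with $\mathrm{var}(\theta)\subseteq\mathrm{var}(F)$ at all times. Initially $\theta$ is empty; the players move alternately, Delayer first. Delayer replaces $\theta$ by any $\theta'\supseteq\theta$. Prover replaces $\theta$ by some partial assignment $\theta'$ compatible with $\theta$ (i.e. agreeing with $\theta$ on $\mathrm{var}(\theta)\cap\mathrm{var}(\theta')$) with $|\mathrm{var}(\theta')\setminus\mathrm{var}(\theta)|=1$ (so Prover may drop assigned variables). As soon as $\bot\in\theta*F$ the game ends, and Delayer receives as points the maximum of $n(\theta')$ over all assignments $\theta'$ chosen by Prover during the game ($0$ if Prover made no move). Prover must play so that the game is finite. Then: (1) if Delayer has a strategy achieving at least $k\in\mathbb{N}$ points against every Prover play, then $\mathrm{whd}(F)\ge k$; (2) if Prover has a strategy guaranteeing that Delayer gets at most $k\in\mathbb{N}_0$ points, then $\mathrm{whd}(F)\le k$; (3) Delayer has a strategy guaranteeing at least $\mathrm{whd}(F)$ points against every Prover play; (4) Prover has a strategy guaranteeing that Delayer gets at most $\mathrm{whd}(F)$ points against every Delayer play.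
   Context: Literals are variables $v$ or negations $\overline{v}$; clauses are finite sets of literals without complementary pair; clause-sets are finite sets of clauses; $\bot$ is the empty clause; $\mathrm{var}(F)$ the set of variables of $F$. A partial assignment $\varphi$ maps a finite variable set $\mathrm{var}(\varphi)$ to $\{0,1\}$, $n(\varphi)=|\mathrm{var}(\varphi)|$; $\varphi*F$ removes satisfied clauses and false literals. $F$ is unsatisfiable if no $\varphi$ satisfies all clauses. Resolution: clauses $C,D$ with exactly one clashing literal $x\in C,\overline{x}\in D$ have resolvent $(C\cup D)\setminus\{x,\overline{x}\}$. A resolution tree is a finite rooted tree, inner nodes having exactly two children, nodes labelled by clauses, each inner label the resolvent of its children's labels; a refutation of $F$ has leaves labelled by clauses of $F$ and root labelled $\bot$. Asymmetric width: $\mathrm{whd}(T)=0$ for a single node; otherwise, with root children labelled $C_1,C_2$ and subtrees $T_1,T_2$, $\mathrm{whd}(T)=\max(\mathrm{whd}(T_1),\mathrm{whd}(T_2),\min(|C_1|,|C_2|))$. $\mathrm{whd}(F)$ is the minimum of $\mathrm{whd}(T)$ over refutations $T$ of $F$. *)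

(* Defs.v *)
From mathcomp Require Import all_boot finmap.
From mathcomp Require Import boolp classical_sets.

Set Implicit Arguments.
Unset Strict Implicit.
Unset Printing Implicit Defensive.

Local Open Scope fset_scope.
Local Open Scope fmap_scope.

(* The literal (v, true) is the variable v, and (v, false) is its negation. *)
Definition literal (V : choiceType) : choiceType := (V * bool)%type.

(* Raw sets of literals; the absence of complementary pairs is is_clause. *)
Definition clause (V : choiceType) : choiceType := {fset literal V}.

Definition passign (V : choiceType) : choiceType := {fmap V -> bool}.

Section ClauseSets.
Variable V : choiceType.
Implicit Types (x : literal V) (C D R : clause V) (F : {fset clause V}).
Implicit Types (phi theta : passign V).

Definition lneg x : literal V := (x.1, ~~ x.2).

Definition is_clause C := forall x, x \in C -> lneg x \notin C.

Definition is_clause_set F := forall C, C \in F -> is_clause C.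

Definition cvar C : {fset V} := [fset x.1 | x in C].

Definition fvar F : {fset V} := \bigcup_(C <- F) cvar C.

Definition ltrue phi x := phi.[? x.1] == Some x.2.
Definition lfalse phi x := phi.[? x.1] == Some (~~ x.2).

Definition csat phi C := has (ltrue phi) C.

Definition unsatisfiable F := ~ exists phi, forall C, C \in F -> csat phi C.

Definition creduce phi C : clause V := [fset x in C | ~~ lfalse phi x].

(* phi * F *)
Definition papply phi F : {fset clause V} :=
  [fset creduce phi C | C in F & ~~ csat phi C].

Definition is_resolvent C D R :=
  exists x, [fset y in C | lneg y \in D] = [fset x] /\
            R = (C `|` D) `\` [fset x; lneg x].

Inductive tree :=
  | Leaf of clause V
  | Node of clause V & tree & tree.

Definition label T := match T with Leaf C => C | Node C _ _ => C end.

Fixpoint resolution_tree T : Prop :=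
  match T with
  | Leaf _ => True
  | Node C T1 T2 => [/\ is_resolvent (label T1) (label T2) C,
                        resolution_tree T1 & resolution_tree T2]
  end.

Fixpoint leaves T : seq (clause V) :=
  match T with
  | Leaf C => [:: C]
  | Node _ T1 T2 => leaves T1 ++ leaves T2
  end.

(* If F is a clause-set then all labels of such a T satisfy is_clause, since a
   resolvent of clauses with a single clash has no complementary pair. *)
Definition refutation F T :=
  [/\ resolution_tree T, {subset leaves T <= F} & label T = fset0].

Fixpoint tree_whd T : nat :=
  match T with
  | Leaf _ => 0
  | Node _ T1 T2 => maxn (maxn (tree_whd T1) (tree_whd T2))
                         (minn #|` label T1| #|` label T2|)
  end.

Definition is_min_whd F w :=
  (exists2 T, refutation F T & tree_whd T = w) /\
  (forall T, refutation F T -> w <= tree_whd T).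

(* The minimum exists whenever F is unsatisfiable, by completeness of
   resolution; the default value 0 is only taken for satisfiable F. *)
Definition whd F : nat := xget 0 (is_min_whd F).

End ClauseSets.

Section Game.
Variable V : choiceType.
Variable F : {fset clause V}.
Implicit Types (theta : passign V) (h : seq (passign V)) (k : nat).

Inductive player := Delayer | Prover.

(* A history lists the assignments chosen so far, in chronological order; the
   empty initial assignment is not listed. *)
Definition current h : passign V := last [fmap] h.

Definition turn h : player := if odd (size h) then Prover else Delayer.

Definition game_over h : bool := (fset0 : clause V) \in papply (current h) F.

Definition extends theta theta' :=
  forall v b, theta.[? v] = Some b -> theta'.[? v] = Some b.

Definition compatible theta theta' :=
  forall v, v \in domf theta `&` domf theta' -> theta.[? v] = theta'.[? v].

Definition legal_move h theta' :=
  [/\ ~~ game_over h, domf theta' `<=` fvar F &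
      match turn h with
      | Delayer => extends (current h) theta'
      | Prover => compatible (current h) theta' /\
                  #|` domf theta' `\` domf (current h)| = 1
      end].

Definition play h :=
  forall i, i < size h -> legal_move (take i h) (nth [fmap] h i).

Definition complete_play h := play h /\ game_over h.

Definition infinite_play (p : nat -> passign V) :=
  forall i, legal_move (mkseq p i) (p i).

(* Delayer moves first, so Prover's choices are the entries of odd index. *)
Definition points h : nat :=
  \max_(i < size h | odd i) #|` domf (nth [fmap] h i)|.

(* A strategy sees the whole history, and must provide a legal move at every
   unfinished play in which it is its owner's turn. *)
Definition strategy (pl : player) (s : seq (passign V) -> passign V) :=
  forall h, play h -> ~~ game_over h -> turn h = pl -> legal_move h (s h).

Definition follows (pl : player) (s : seq (passign V) -> passign V) h :=
  forall i, i < size h -> turn (take i h) = pl ->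
    nth [fmap] h i = s (take i h).

Definition infinite_follows (pl : player) (s : seq (passign V) -> passign V)
    (p : nat -> passign V) :=
  forall i, turn (mkseq p i) = pl -> p i = s (mkseq p i).

(* Keeping the game finite is an obligation of Prover: infinite plays do not
   count against a strategy of Delayer, and a strategy of Prover must exclude
   them. *)
Definition delayer_achieves (s : seq (passign V) -> passign V) k :=
  strategy Delayer s /\
  (forall h, complete_play h -> follows Delayer s h -> k <= points h).

Definition prover_guarantees (s : seq (passign V) -> passign V) k :=
  [/\ strategy Prover s,
      (forall p, infinite_play p -> ~ infinite_follows Prover s p) &
      (forall h, complete_play h -> follows Prover s h -> points h <= k)].

End Game.

(* Main.v *)
(* Prover walks down an optimal refutation, keeping the current label falsified.
   If Delayer has assigned the resolved variable, the walk passes for free to the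
   falsified child; otherwise Prover moves to the smaller child C, by choosing
   the assignment that falsifies exactly C, which costs |C|.

   Delayer keeps all clauses derivable with asymmetric width < w = whd(F)
   unfalsified and always moves to a maximal such assignment theta.  Suppose a
   Prover move on a new variable v, with fewer than w variables, falsifies such a
   clause C.  Then v occurs in C and |C| < w, while by maximality the opposite
   value of v falsifies another such clause D; the resolvent of C and D is
   derivable with width < w and falsified by theta, a contradiction.

   With w > |var(F)| the same argument yields the completeness of resolution.
   Parts (1) and (2) follow by playing two strategies against each other. *)

Require Import Defs.
From mathcomp Require Import all_boot finmap.
From mathcomp Require Import boolp classical_sets.

Set Implicit Arguments.
Unset Strict Implicit.
Unset Printing Implicit Defensive.

Local Open Scope fset_scope.
Local Open Scope fmap_scope.

(** * Clauses, resolvents and falsified clauses *)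

Section Resolution.
Variable V : choiceType.
Implicit Types (x y : literal V) (C D R : clause V) (F : {fset clause V}).
Implicit Types (th : passign V) (T : tree V).

Lemma lnegK : involutive (@lneg V).
Proof. by case=> v b; rewrite /lneg /= negbK. Qed.

Lemma mem_cvar C x : x \in C -> x.1 \in cvar C.
Proof. by move=> xC; apply/imfsetP; exists x. Qed.

Lemma cvarP C v : reflect (exists2 x, x \in C & v = x.1) (v \in cvar C).
Proof. exact: imfsetP. Qed.

Lemma leq_card_cvar C : #|` cvar C| <= #|` C|.
Proof. exact: leq_imfset_card. Qed.

Lemma eq_or_lneg x y : x.1 = y.1 -> x = y \/ x = lneg y.
Proof.
by case: x y => v b [u c] /= ->; case: b c => -[]; [left|right|right|left].
Qed.

Lemma clause_var_inj C x y :
  is_clause C -> x \in C -> y \in C -> x.1 = y.1 -> x = y.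
Proof.
by move=> clC xC /clC yC /eq_or_lneg[//|xE]; rewrite -xE xC in yC.
Qed.

Lemma card_cvar C : is_clause C -> #|` cvar C| = #|` C|.
Proof.
move=> clC; apply: card_in_imfset => x y xC yC.
exact: clause_var_inj xC yC.
Qed.

Lemma cvar_fvar F C : C \in F -> cvar C `<=` fvar F.
Proof. by move=> CF; apply: (bigfcup_sup _ CF). Qed.

(** A complementary pair in [R] would lie within one parent or clash between the two, and the only
    clash is the removed pair. *)
Lemma resolvent_clause C D R :
  is_clause C -> is_clause D -> is_resolvent C D R -> is_clause R.
Proof.
move=> clC clD [x [clash ->]] y; rewrite !inE.
move=> /andP[/norP[nyx nynx] yCD]; apply/negP => /andP[/norP[nx _] nCD].
have clE z : z \in C -> lneg z \in D -> z = x.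
  by move=> zC zD; apply/fset1P; rewrite -clash !inE zC.
case/orP: yCD => yE; case/orP: nCD => nyE.
- by have := clC _ yE; rewrite nyE.
- by move: nyx; rewrite (clE _ yE nyE) eqxx.
- by move: nx; rewrite (clE _ nyE) ?eqxx // lnegK.
- by have := clD _ yE; rewrite nyE.
Qed.

(** The exceptional cases [y = lneg x] and [y = x] are impossible once the parents have no
    complementary pair. *)
Lemma resolvent_clash C D R : is_resolvent C D R ->
  exists x, [/\ x \in C, lneg x \in D,
     forall y, y \in C -> y != x -> y \in R \/ y = lneg x &
     forall y, y \in D -> y != lneg x -> y \in R \/ y = x].
Proof.
move=> [x [clash ->]]; exists x.
have /andP[xC xD] : (x \in C) && (lneg x \in D).
  by have := fset11 x; rewrite -clash !inE.
split=> // y yE yx; rewrite !inE yE (negbTE yx) /= ?orbT ?orbF ?andbT.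
  by case: eqVneq; [right | left].
by case: eqVneq; [right | left].
Qed.

Definition derivation F T := resolution_tree T /\ {subset leaves T <= F}.

Lemma derivation_node F C T1 T2 : derivation F (Node C T1 T2) ->
  [/\ is_resolvent (label T1) (label T2) C, derivation F T1 & derivation F T2].
Proof.
by move=> [[res t1 t2] sub]; split=> //; split=> // D DT;
  apply: sub; rewrite /= mem_cat DT ?orbT.
Qed.

Lemma derivation_clause F T : is_clause_set F -> derivation F T ->
  is_clause (label T) /\ cvar (label T) `<=` fvar F.
Proof.
move=> hF; elim: T => [C|C T1 IH1 T2 IH2].
  move=> [_ sub]; have CF : C \in F by apply: sub; rewrite mem_head.
  by split; [apply: hF | apply: cvar_fvar].
move=> /derivation_node[res /IH1[cl1 v1] /IH2[cl2 v2]]; split.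
  exact: resolvent_clause res.
case: res => x [_ ->]; apply/fsubsetP => v /cvarP[y + ->] /=.
rewrite !inE => /andP[_ /orP[]] /mem_cvar.
  exact: (fsubsetP v1).
exact: (fsubsetP v2).
Qed.

Definition falsifies th C := all (lfalse th) C.

Lemma falsifiesP th C :
  reflect (forall x, x \in C -> th.[? x.1] = Some (~~ x.2)) (falsifies th C).
Proof. by apply: (iffP allP) => fC x /fC /eqP. Qed.

Lemma extends_falsifies th th' C :
  extends th th' -> falsifies th C -> falsifies th' C.
Proof. by move=> ext /falsifiesP fC; apply/falsifiesP => x /fC /ext. Qed.

Lemma papply_bot th F :
  reflect (exists2 C, C \in F & falsifies th C) (fset0 \in papply th F).
Proof.
apply: (iffP (imfsetP _ _ _ _)) => /= [[C]|[C CF fC]].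
  rewrite !inE => /andP[CF _] red; exists C => //; apply/allP => x xC.
  apply/negPn/negP => nf; have := in_fset0 x.
  by rewrite red !inE xC nf.
exists C.
  rewrite !inE CF /=; apply/hasPn => x xC.
  have /eqP := allP fC _ xC; rewrite /ltrue => ->.
  by case: (x.2).
by apply/fsetP => x; rewrite !inE; case: (boolP (x \in C)) => //= /(allP fC) ->.
Qed.

End Resolution.

(** * Consistent assignments: the invariant of Delayer *)

Section Extension.
Variables (V : choiceType) (F : {fset clause V}).
Hypotheses (hF : is_clause_set F).
Implicit Types (C D R : clause V) (th : passign V).

(** The bound is strict so that for [w = whd F] the empty clause is excluded. *)
Definition whd_derivable w C :=
  exists T, [/\ derivation F T, label T = C & tree_whd T < w].

Definition consistent w th := forall C, whd_derivable w C -> ~~ falsifies th C.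

(** One-variable extensions suffice for maximality, since consistency passes to subassignments. *)
Definition maximal_consistent w th :=
  consistent w th /\ forall v b, v \in fvar F -> v \notin domf th ->
    ~ consistent w th.[v <- b].

Lemma consistent_extension w th : domf th `<=` fvar F -> consistent w th ->
  exists th', [/\ extends th th', domf th' `<=` fvar F &
                  maximal_consistent w th'].
Proof.
have [n] := ubnP #|` fvar F `\` domf th|; elim: n th => // n IH th le_n dom con.
have [|nmax] := pselect (maximal_consistent w th); first by exists th; split.
have [v [b [vF vth conv]]] : exists v b, [/\ v \in fvar F, v \notin domf th &
    consistent w th.[v <- b]].
  apply/not_existsP => none; apply: nmax; split=> // v b vF vth conv.
  by apply: (none v); exists b.
have ext : extends th th.[v <- b].
  move=> u c uc; rewrite fnd_set; case: eqP => // uv.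
  by move: vth; rewrite -uv -fndSome uc.
have [||th' [ext' dom' max']] := IH th.[v <- b] _ _ conv.
- rewrite -ltnS; apply: leq_trans le_n; rewrite ltnS; apply: fproper_ltn_card.
  rewrite fproperE; apply/andP; split.
    by apply: fsetDS; apply: fsubsetUr.
  by apply/fsubsetPn; exists v; rewrite !inE ?eqxx ?vth ?vF.
- by rewrite /= fsubUset fsub1set vF.
by exists th'; split=> // u c /ext /ext'.
Qed.

Lemma falsifies_set_mem th x C :
  ~~ falsifies th C -> falsifies th.[x.1 <- ~~ x.2] C -> x \in C.
Proof.
move=> nf /falsifiesP f; apply: contraR nf => xC; apply/falsifiesP => y yC.
have := f _ yC; rewrite fnd_set; case: eqP => // yx [/negb_inj xy2].
by move: xC; rewrite (_ : x = y) ?yC //; case: x y yx xy2 {f yC} => ? ? [? ?] /= -> ->.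
Qed.

(** Asymmetric width charges only the smaller parent, so [C] alone needs a size bound. The clash is
    unique because [th] falsifies all other literals of both parents. *)
Lemma whd_derivable_resolve w C D th x : x.1 \notin domf th ->
  whd_derivable w C -> whd_derivable w D -> #|` C| < w ->
  x \in C -> lneg x \in D ->
  falsifies th.[x.1 <- ~~ x.2] C -> falsifies th.[x.1 <- x.2] D ->
  exists2 R, whd_derivable w R & falsifies th R.
Proof.
move=> xth [T1 [d1 l1 w1]] [T2 [d2 l2 w2]] ltC xC xD /falsifiesP fC /falsifiesP fD.
pose R := (C `|` D) `\` [fset x; lneg x].
exists R; last first.
  apply/falsifiesP => y; rewrite !inE => /andP[nyx yCD].
  have yx1 : (y.1 == x.1) = false.
    by apply: contraNF nyx => /eqP /eq_or_lneg[] ->; rewrite eqxx ?orbT.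
  by case/orP: yCD => [/fC|/fD]; rewrite fnd_set yx1.
have cl1 := (derivation_clause hF d1).1; have cl2 := (derivation_clause hF d2).1.
exists (Node R T1 T2); split=> //; last first.
  by rewrite /= !gtn_max w1 w2 gtn_min l1 ltC.
case: d1 d2 => [t1 s1] [t2 s2]; split; last first.
  by move=> E /=; rewrite mem_cat => /orP[/s1|/s2].
split=> //; rewrite l1 l2; exists x; split=> //.
apply/fsetP => y; rewrite !inE; apply/andP/eqP => [[yC yD]|-> //].
have [yx1|/eqP/negbTE yx1] := (y.1 =P x.1).
  case: (eq_or_lneg yx1) => // yE.
  by have := cl1 x; rewrite l1 => /(_ xC); rewrite -yE yC.
have := fC _ yC; have := fD _ yD; rewrite !fnd_set /= yx1 => -> [].
by case: (y.2).
Qed.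

Lemma consistent_prover_move w th th' :
  maximal_consistent w th -> domf th' `<=` fvar F -> compatible th th' ->
  #|` domf th' `\` domf th| = 1 -> #|` domf th'| < w -> consistent w th'.
Proof.
move=> [con max] dom comp /eqP/cardfs1P[v newv] ltw C dC.
have vth : v \notin domf th /\ v \in domf th'.
  by apply/andP; have := fset11 v; rewrite -newv inE.
case: vth => vth vth'; have vF := fsubsetP dom _ vth'.
apply/negP => fC.
have [b vb] : exists b, th'.[? v] = Some b by exists th'.[vth']; apply: in_fnd.
(* Away from [v], [th'] only drops values of [th]; restoring them keeps [C] falsified. *)
have fC' : falsifies th.[v <- b] C.
  apply/falsifiesP => y yC; have yE := falsifiesP _ _ fC _ yC.
  rewrite fnd_set; case: eqP => [yv|/eqP yv]; first by rewrite -yE yv vb.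
  have yth' : y.1 \in domf th' by rewrite -fndSome yE.
  have yth : y.1 \in domf th.
    apply: contraR yv => nyth.
    by rewrite -in_fset1 -newv inE nyth.
  by rewrite comp // inE yth.
(* A clause has one literal per variable, and [th'] assigns all variables of [C]. *)
have leC : #|` C| < w.
  case: (dC) => T [dT lT _]; apply: leq_ltn_trans ltw.
  rewrite -card_cvar; last by rewrite -lT; exact: (derivation_clause hF dT).1.
  apply: fsubset_leq_card; apply/fsubsetP => u /cvarP[y /(falsifiesP _ _ fC) yE ->].
  by rewrite -fndSome yE.
(* The literal on [v] made false by the value [b]. *)
pose x : literal V := (v, ~~ b).
have xC : x \in C.
  by apply: (@falsifies_set_mem th); [apply: con | rewrite /= negbK].
have [D dD fD] : exists2 D, whd_derivable w D & falsifies th.[v <- ~~ b] D.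
  apply: contrapT => none; apply: (max v (~~ b) vF vth) => D dD.
  by apply/negP => fD; apply: none; exists D.
have xD : lneg x \in D.
  by apply: (@falsifies_set_mem th); [apply: con | rewrite /= negbK].
have [||R dR fR] := @whd_derivable_resolve w C D th x vth dC dD leC xC xD.
- by rewrite /= negbK.
- by [].
by have := con _ dR; rewrite fR.
Qed.

(** The empty assignment falsifies only the empty clause, whose derivations are refutations. *)
Lemma consistent_empty w :
  (forall T, refutation F T -> w <= tree_whd T) -> consistent w [fmap].
Proof.
move=> minw C [T [[tT sT] lT ltw]]; apply/negP => /falsifiesP fC.
have C0 : C = fset0.
  by apply/fsetP => x; rewrite !inE; apply/negP => /fC; rewrite fnd_fmap0.
have /minw : refutation F T by split; rewrite ?lT.
by rewrite leqNgt ltw.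
Qed.

Lemma consistent_not_bot w th :
  0 < w -> consistent w th -> fset0 \notin papply th F.
Proof.
move=> w0 con; apply/papply_bot => -[C CF fC].
suff /con : whd_derivable w C by rewrite fC.
by exists (Leaf C); split=> //; split=> // D; rewrite inE => /eqP ->.
Qed.

(** * Completeness of resolution, and moves of Prover along a derivation *)

Hypothesis uF : unsatisfiable F.

Lemma unassigned_variable th : domf th `<=` fvar F ->
  fset0 \notin papply th F -> exists2 v, v \in fvar F & v \notin domf th.
Proof.
move=> dom /papply_bot nb; apply: contrapT => none; apply: uF; exists th => C CF.
apply: contrapT => /negP nsat; apply: nb; exists C => //.
apply/allP => x xC; have := hasPn nsat _ xC; rewrite /ltrue /lfalse.
have : x.1 \in domf th.
  apply: contrapT => /negP nx; apply: none; exists x.1 => //.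
  exact: (fsubsetP (cvar_fvar CF) _ (mem_cvar xC)).
rewrite -fndSome; case: (th.[? x.1]) => //= b _.
by case: b (x.2) => -[].
Qed.

Lemma resolution_complete : exists T, refutation F T.
Proof.
(* No assignment over [fvar F] has [w] variables, so setting one more variable always counts as a
   cheap Prover move and contradicts maximality. *)
apply: contrapT => none; pose w := #|` fvar F|.+1.
have con0 : consistent w [fmap].
  by apply: consistent_empty => T rT; case: none; exists T.
have [|th [_ dom max]] := consistent_extension _ con0; first exact: fsub0set.
have [v vF vth] : exists2 v, v \in fvar F & v \notin domf th.
  by apply: unassigned_variable => //; apply: (@consistent_not_bot w) => //; case: max.
have domv : domf th.[v <- true] `<=` fvar F by rewrite /= fsubUset fsub1set vF.
apply: (max.2 v true vF vth); apply: (consistent_prover_move max domv).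
- move=> u; rewrite inE => /andP[uth _]; rewrite fnd_set; case: eqP => // uv.
  by move: vth; rewrite -uv uth.
- apply/eqP/cardfs1P; exists v; apply/fsetP => u; rewrite !inE.
  by case: eqVneq => [->|_] /=; rewrite ?vth // andNb.
- by rewrite /w ltnS; apply: fsubset_leq_card.
Qed.

Lemma whdP : is_min_whd F (whd F).
Proof.
rewrite /whd; apply: xgetPex.
have ex : exists n, `[< exists2 T, refutation F T & tree_whd T = n >].
  by case: resolution_complete => T rT; exists (tree_whd T); apply/asboolP; exists T.
case: (ex_minnP ex) => w /asboolP rw minw; exists w; split=> // T rT.
by apply: minw; apply/asboolP; exists T.
Qed.

(* Any derivation qualifies, not only a subtree of the chosen refutation; this
   makes Prover's strategy depend on the current assignment alone, and the least
   such n decreases in each round. *)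
Definition reaches w th n := exists T,
  [/\ derivation F T, tree_whd T <= w, falsifies th (label T) &
      size (leaves T) <= n].

Lemma reaches_extends w th th' n :
  extends th th' -> reaches w th n -> reaches w th' n.
Proof.
by move=> ext [T [dT wT fT sT]]; exists T; split=> //; apply: extends_falsifies fT.
Qed.

Lemma size_leaves_gt0 (T : tree V) : 0 < size (leaves T).
Proof. by elim: T => //= C T1 IH1 T2 _; rewrite size_cat addn_gt0 IH1. Qed.

Lemma restrict_move w th x C T n :
  derivation F T -> tree_whd T <= w -> size (leaves T) <= n ->
  label T = C -> #|` C| <= w -> x \in C -> x.1 \notin domf th ->
  (forall y, y \in C -> y != x -> th.[? y.1] = Some (~~ y.2)) ->
  exists th', [/\ domf th' `<=` fvar F, compatible th th',
    #|` domf th' `\` domf th| = 1, #|` domf th'| <= w & reaches w th' n].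
Proof.
move=> dT wT sT lT leC xC xth fC.
have [clC varC] := derivation_clause hF dT; rewrite lT in clC varC.
(* Falsify [x], then forget every variable outside [C]; the size is then at most [|C|]. *)
pose th' := th.[x.1 <- ~~ x.2].[& cvar C].
have fE v : th'.[? v] = if v \in cvar C then
    if v == x.1 then Some (~~ x.2) else th.[? v] else None.
  by rewrite fnd_restrict fnd_set.
have sub : domf th' `<=` cvar C.
  apply/fsubsetP => v; rewrite -fndSome fE; by case: ifP.
exists th'; split.
- exact: fsubset_trans varC.
- move=> v; rewrite inE => /andP[vth vth']; rewrite fE (fsubsetP sub) //.
  by case: eqP => // vx; move: xth; rewrite -vx vth.
- apply/eqP/cardfs1P; exists x.1; apply/fsetP => v.
  rewrite in_fsetD in_fset1 -!fndSome fE.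
  case: eqVneq => [->|vx]; first by rewrite mem_cvar // andbT fndSome.
  by case: ifP => _; rewrite ?andNb ?andbF.
- by apply: leq_trans leC; apply: leq_trans (leq_card_cvar C); apply: fsubset_leq_card.
exists T; split=> //; rewrite lT; apply/falsifiesP => y yC.
rewrite fE mem_cvar //; case: eqVneq => [yx1|yx1].
  by rewrite (clause_var_inj clC yC xC yx1).
by apply: fC => //; apply: contraNneq yx1 => ->.
Qed.

Lemma reaches_move w th n : fset0 \notin papply th F -> reaches w th n ->
  exists th', [/\ domf th' `<=` fvar F, compatible th th',
    #|` domf th' `\` domf th| = 1, #|` domf th'| <= w &
    exists2 m, m < n & reaches w th' m].
Proof.
(* The induction performs the free steps of the walk, with [th] fixed. It cannot end in a leaf,
   since [th] falsifies no clause of [F]. *)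
move=> nb [T [dT wT fT sT]]; elim: T n dT wT fT sT => [C|C T1 IH1 T2 IH2] n.
  move=> [_ sub] _ fC _; case/papply_bot: nb; exists C => //.
  by apply: sub; rewrite mem_head.
move=> dT; have [clC _] := derivation_clause hF dT.
have [/resolvent_clash[x [x1 x2 r1 r2]] d1 d2] := derivation_node dT.
have [cl1 _] := derivation_clause hF d1; have [cl2 _] := derivation_clause hF d2.
rewrite /= !geq_max size_cat => /andP[/andP[w1 w2] wm] /falsifiesP fC sT.
have n1 : size (leaves T1) < n.
  by apply: leq_trans sT; rewrite -ltn_subLR // subnn size_leaves_gt0.
have n2 : size (leaves T2) < n.
  by apply: leq_trans sT; rewrite addnC -ltn_subLR // subnn size_leaves_gt0.
have f1 y : y \in label T1 -> y != x -> th.[? y.1] = Some (~~ y.2).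
  move=> yT yx; case: (r1 _ yT yx) => [/fC //|yE].
  by have := cl1 _ x1; rewrite -yE yT.
have f2 y : y \in label T2 -> y != lneg x -> th.[? y.1] = Some (~~ y.2).
  move=> yT yx; case: (r2 _ yT yx) => [/fC //|yE].
  by have := cl2 _ x2; rewrite lnegK -yE yT.
(* If [x.1] is assigned, one of [x] and [lneg x] is false, hence so is the whole label of that
   child. *)
have [xth|xth] := boolP (x.1 \in domf th).
  have [b xb] : exists b, th.[? x.1] = Some b by exists th.[xth]; apply: in_fnd.
  have [bx|bx] := eqVneq b (~~ x.2).
    apply: IH1 (ltnW n1) => //; apply/falsifiesP => y yT.
    by have [->|/(f1 _ yT) //] := eqVneq y x; rewrite xb bx.
  apply: IH2 (ltnW n2) => //; apply/falsifiesP => y yT.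
  have [->|/(f2 _ yT) //] := eqVneq y (lneg x); rewrite xb; congr Some.
  by move: bx; rewrite /=; case: b (x.2) {xb} => -[].
move: wm; rewrite geq_min => /orP[] lew.
  have [th' [? ? ? ? ?]] := restrict_move d1 w1 (leqnn _) erefl lew x1 xth f1.
  by exists th'; split=> //; exists (size (leaves T1)).
have [th' [? ? ? ? ?]] := restrict_move d2 w2 (leqnn _) erefl lew x2 xth f2.
by exists th'; split=> //; exists (size (leaves T2)).
Qed.

End Extension.

(** * Plays and strategies of both players *)

Section Strategies.
Variables (V : choiceType) (F : {fset clause V}).
Hypotheses (hF : is_clause_set F) (uF : unsatisfiable F).
Implicit Types (th : passign V) (h : seq (passign V)).
Implicit Types (s : seq (passign V) -> passign V).

Lemma current_rcons h th : current (rcons h th) = th.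
Proof. exact: last_rcons. Qed.

Lemma current_take h i : i < size h -> current (take i.+1 h) = nth [fmap] h i.
Proof. by move=> ih; rewrite (take_nth [fmap]) // current_rcons. Qed.

Lemma current_mkseq (p : nat -> passign V) i : current (mkseq p i.+1) = p i.
Proof. by rewrite /current -nth_last size_mkseq nth_mkseq. Qed.

Lemma play_take h i : play F h -> play F (take i h).
Proof.
move=> ph j; rewrite size_take_min leq_min => /andP[ji jh].
by rewrite take_takel 1?ltnW // nth_take //; apply: ph.
Qed.

Lemma play_rcons h th : play F h -> legal_move F h th -> play F (rcons h th).
Proof.
move=> ph mv i; rewrite size_rcons ltnS leq_eqVlt => /predU1P[->|ih].
  by rewrite -cats1 take_size_cat // nth_cat ltnn subnn.
by rewrite -cats1 takel_cat ?(ltnW ih) // nth_cat ih; apply: ph.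
Qed.

Lemma follows_rcons pl s h th : follows pl s h ->
  (turn h = pl -> th = s h) -> follows pl s (rcons h th).
Proof.
move=> fh mv i; rewrite size_rcons ltnS leq_eqVlt => /predU1P[->|ih].
  by rewrite -cats1 take_size_cat // nth_cat ltnn subnn.
by rewrite -cats1 takel_cat ?(ltnW ih) // nth_cat ih; apply: fh.
Qed.

Lemma play_fvar h : play F h -> domf (current h) `<=` fvar F.
Proof.
case/lastP: h => [|h th] ph; first exact: fsub0set.
have := ph (size h); rewrite size_rcons ltnSn => /(_ isT).
rewrite nth_rcons ltnn eqxx => -[_ dom _].
by rewrite current_rcons.
Qed.

Lemma delayer_strategy : exists s, delayer_achieves F s (whd F).
Proof.
set w := whd F.
(* Maximality is conditional because a strategy also has to move legally from inconsistent
   positions. *)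
pose ok th th' := [/\ extends th th', domf th' `<=` fvar F &
  consistent F w th -> maximal_consistent F w th'].
have okP th : domf th `<=` fvar F -> ok th (xget th (ok th)).
  move=> dom; apply: xgetPex.
  have [con|ncon] := pselect (consistent F w th).
    by have [th' [? ? ?]] := consistent_extension dom con; exists th'; split.
  by exists th; split.
exists (fun h => xget (current h) (ok (current h))); split.
  move=> h ph nover tn; have [ext dom _] := okP _ (play_fvar ph).
  by split=> //; rewrite tn.
move=> h [ph over] fh; rewrite leqNgt; apply/negP => lt_w.
(* Prefixes of odd length end with a Delayer move, which restores maximality. *)
have inv i : i <= size h -> consistent F w (current (take i h)) /\
    (odd i -> maximal_consistent F w (current (take i h))).
  elim: i => [_|i IH ih].
    rewrite take0; split=> //; apply: consistent_empty.
    by case: (whdP hF uF).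
  have [con max] := IH (ltnW ih); rewrite current_take //.
  have [_ dom] := ph _ ih; have := fh _ ih.
  rewrite /turn size_take_min (minn_idPl (ltnW ih)) /=.
  case: (boolP (odd i)) => [oi _ [comp new]|ei -> // _].
    split=> //; apply: (consistent_prover_move hF (max oi) dom comp new).
    apply: leq_ltn_trans lt_w.
    exact: (@leq_bigmax_cond _ _ (fun j : 'I__ => #|` domf (nth [fmap] h j)|)
             (Ordinal ih)).
  have [_ _ /(_ con)[con' max']] := okP _ (play_fvar (play_take (i := i) ph)).
  by split.
have [con _] := inv _ (leqnn _); rewrite take_size in con.
have /negP := consistent_not_bot (leq_ltn_trans (leq0n _) lt_w) con.
by apply.
Qed.

Lemma prover_strategy : exists s, prover_guarantees F s (whd F).
Proof.
set w := whd F.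
have [T [dT sT lT] wT] := (whdP hF uF).1.
(* Every assignment falsifies the empty label of the root. *)
have start th : reaches F w th (size (leaves T)).
  exists T; split=> //; first by rewrite wT.
  by rewrite lT; apply/falsifiesP => x; rewrite inE.
pose ok th th' := [/\ domf th' `<=` fvar F, compatible th th',
    #|` domf th' `\` domf th| = 1, #|` domf th'| <= w &
    forall n, reaches F w th n -> exists2 m, m < n & reaches F w th' m].
have okP th : fset0 \notin papply th F -> ok th (xget th (ok th)).
  move=> nb; apply: xgetPex.
  (* A move that gets below the least reachable [n] gets below all of them. *)
  have ex : exists n, `[< reaches F w th n >].
    by exists (size (leaves T)); apply/asboolP.
  case: (ex_minnP ex) => n /asboolP rn minn.
  have [th' [? ? ? ? [m mn rm]]] := reaches_move hF nb rn.
  exists th'; split=> // k /asboolP /minn nk.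
  by exists m => //; apply: leq_trans nk.
exists (fun h => xget (current h) (ok (current h))); split.
- move=> h ph nover tn; have [dom comp new _ _] := okP _ nover.
  by split=> //; rewrite tn.
- move=> p legal fp.
  (* Infinite descent: Prover's move at [i.+1] lowers [n], and Delayer's extension at [i.+2]
     preserves the new bound. *)
  have noreach n i : ~~ odd i -> ~ reaches F w (p i) n.
    elim/ltn_ind: n i => n IH i ei rn.
    have [nover _ _] := legal i.+1; have := fp i.+1.
    rewrite /turn size_mkseq /= ei => /(_ erefl) pE.
    have [_ _ _ _] := okP _ nover; rewrite -pE current_mkseq => /(_ _ rn)[m mn rm].
    apply: (IH m mn i.+2); first by rewrite /= negbK.
    have [_ _] := legal i.+2; rewrite /turn size_mkseq /= negbK (negbTE ei).
    by rewrite current_mkseq => ext; apply: reaches_extends rm.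
  exact: (noreach _ 0 isT (start _)).
move=> h [ph _] fh; apply/bigmax_leqP => i oi.
have := fh _ (ltn_ord i); have [nover _ _] := ph _ (ltn_ord i).
rewrite /turn size_take_min (minn_idPl (ltnW (ltn_ord i))) oi => /(_ erefl) ->.
by case: (okP _ nover).
Qed.

(** The play in which both strategies are followed is finite thanks to [sP], and its points lie
    between [k] and [l]. *)
Lemma delayer_le_prover sD sP k l :
  delayer_achieves F sD k -> prover_guarantees F sP l -> k <= l.
Proof.
move=> [stD ptD] [stP finP ptP].
pose move h := if turn h is Delayer then sD h else sP h.
pose hist := fix hist n := if n is m.+1 then rcons (hist m) (move (hist m)) else [::].
have follow n : follows Delayer sD (hist n) /\ follows Prover sP (hist n).
  elim: n => [|n [fD fP]]; first by split.
  by split; apply: follows_rcons; rewrite // /move => ->.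
have legal n : play F (hist n) -> ~~ game_over F (hist n) ->
    legal_move F (hist n) (move (hist n)).
  move=> pn nover; rewrite /move; case tn: (turn _); first exact: stD.
  exact: stP.
have playn n : (forall m, m < n -> ~~ game_over F (hist m)) -> play F (hist n).
  elim: n => [_ //|n IH nover]; have pn := IH (fun m mn => nover m (ltnW mn)).
  by apply: play_rcons => //; apply: legal => //; apply: nover.
have [ex|none] := pselect (exists n, game_over F (hist n)).
  (* The first finished position is taken, as moves are legal only before the end. *)
  case: (ex_minnP ex) => n over minn.
  have cn : complete_play F (hist n).
    by split=> //; apply: playn => m; apply: contraL => /minn; rewrite -leqNgt.
  have [fD fP] := follow n.
  exact: leq_trans (ptD _ cn fD) (ptP _ cn fP).
have nover n : ~~ game_over F (hist n) by apply/negP => over; apply: none; exists n.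
(* A game that never ends would be an infinite play following [sP]. *)
have histE n : hist n = mkseq (fun i => move (hist i)) n.
  by elim: n => //= n IH; rewrite [in LHS]IH mkseqS IH.
case: (finP (fun i => move (hist i))).
  by move=> i; rewrite -histE; apply: legal => //; apply: playn.
by move=> i; rewrite -histE /move => ->.
Qed.

End Strategies.

Theorem theorem5p12 (V : choiceType) (F : {fset clause V})
    (hF : is_clause_set F) (uF : unsatisfiable F) :
  [/\ (forall k : nat, 0 < k ->
         (exists s, delayer_achieves F s k) -> k <= whd F),
      (forall k : nat,
         (exists s, prover_guarantees F s k) -> whd F <= k),
      (exists s, delayer_achieves F s (whd F)) &
      (exists s, prover_guarantees F s (whd F))].
Proof.
have [sD dD] := delayer_strategy hF uF; have [sP gP] := prover_strategy hF uF.
split; [| |by exists sD|by exists sP].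
- by move=> k _ [s ds]; apply: delayer_le_prover ds gP.
- by move=> k [s gs]; apply: delayer_le_prover dD gs.
Qed.
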